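(* Let $\Delta=(\delta_i)_{i=0}^g$ be a $\delta$-sequence, with $n_i=n_i(\Delta)$ for $0\le i\le g$ and $a_i=\delta_i/\prod_{k=i+1}^g n_k$. Let $\Delta'=(\delta_i')_{i=0}^{g+1}$ be a sequence of positive integers, with $d_i'=d_i(\Delta')$ for $1\le i\le g+2$, $n_i'=n_i(\Delta')$ for $1\le i\le g+1$, and $a_i'=\delta_i'/\prod_{k=i+1}^{g+1}n_k'$. Let $S_\Delta$ and $S_{\Delta'}$ be the semigroups generated by $\Delta$ and $\Delta'$. (a) Assume that $\Delta'=(\beta,\delta_0,\delta_1,\ldots,\delta_g)$. Then $\Delta'$ is a principal $\delta$-sequence with $S_{\Delta'}=S_\Delta$ if and only if $\beta=\alpha\delta_0$ for some integer $\alpha>1$. (b) Assume again that $\Delta'=(\beta,\delta_0,\delta_1,\ldots,\delta_g)$. Then $\Delta'$ is a non-principal $\delta$-sequence with $S_{\Delta'}=S_\Delta$ if and only if there exists an index $j$, $1\le j\le g$, such that the following conditions hold: 1. $\beta=n_{j+1}'\,\delta_{j+1}'=n_{j+1}'\,a_j\prod_{k=j+1}^g n_k$. 2. If $j=1$, then $n_{k+1}'=n_k$ for $2\le k\le g$. Additionally, $n_1=a_1'\,n_2'$ with $a_1',n_2'>1$, and $n_1'$ is a divisor of $a_1$ such that $a_1'<n_1'$ and $\gcd(a_1',n_1')=1$. 3. If $j\ge 2$, then $$\gcd\Big(a_j,\prod_{k=1}^{j-1}n_k\Big)>\gcd\Big(a_j,\prod_{k=2}^{j-1}n_k\Big)>\cdots>\gcd(a_j,n_{j-1})>1.$$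 Moreover, $n_1'$ is a divisor of $a_j$ with $1<n_1'<a_j$; for $1\le k\le j$, $n_{k+1}'$ is a divisor of $n_k$ with $n_{k+1}'>1$; and there is an index $k_0$, $1\le k_0\le j$, such that $n_{k_0+1}'\ne n_{k_0}$. In addition, $n_{k+1}'=n_k$ for $j+1\le k\le g$. 4. $\beta>\delta_0$, and $\delta_k<n_k'\,\delta_{k-1}$ for $2\le k\le \min(j+1,g)$. 5. $n_1'\delta_0$ is a multiple of $\beta$ and, for $1\le k\le j$, $n_{k+1}'\delta_k$ belongs to the semigroup $\langle\beta,\delta_0,\ldots,\delta_{k-1}\rangle$. (c) Assume that $\Delta'=(\delta_0,\delta_1,\ldots,\delta_{h-1},\beta,\delta_h,\ldots,\delta_g)$ for some index $h$, $1\le h\le g$. Then $\Delta'$ is a $\delta$-sequence with $S_{\Delta'}=S_\Delta$ if and only if there exists an index $j$, $h\le j\le g$, such that the following conditions hold: 1. $\beta=n_{j+1}'\,\delta_{j+1}'=n_{j+1}'\,a_j\prod_{k=j+1}^g n_k$. 2. The value $a_j$ and the sequence $(n_k)_{k=h}^j$ satisfy $$\prod_{k=h}^{j}n_k>\gcd\Big(a_j,\prod_{k=h}^{j-1}n_k\Big)>\gcd\Big(a_j,\prod_{k=h+1}^{j-1}n_k\Big)>\cdots>\gcd(a_j,n_{j-1})>1$$ (the intermediate terms are $\gcd(a_j,\prod_{k=\ell}^{j-1}n_k)$ for $\ell=h,h+1,\ldots,j-1$; if $j=h$ there are no intermediate terms and the chain reads $n_h>1$). Moreover, $n_k'=n_k$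 for $1\le k\le h-1$ (only if $h>1$); $n_h'$ is a divisor of $\prod_{k=h}^j n_k$ with $1<n_h'<\prod_{k=h}^j n_k$; for $h\le k\le j$, $n_{k+1}'$ is a divisor of $n_k$ with $n_{k+1}'>1$; and there is an index $k_0$, $h\le k_0\le j$, such that $n_{k_0+1}'\ne n_{k_0}$. In addition, $n_{k+1}'=n_k$ for $j+1\le k\le g$. 3. $\delta_h<n_h'\,\beta<n_h'\,n_{h-1}\,\delta_{h-1}$, and $\delta_k<n_k'\,\delta_{k-1}$ for $h+1\le k\le\min(j+1,g)$. 4. $n_h'\beta\in\langle\delta_0,\delta_1,\ldots,\delta_{h-1}\rangle$, $n_{h+1}'\delta_h\in\langle\delta_0,\delta_1,\ldots,\delta_{h-1},\beta\rangle$, and $n_k'\delta_{k-1}\in\langle\delta_0,\delta_1,\ldots,\delta_{h-1},\beta,\delta_h,\ldots,\delta_{k-2}\rangle$ for $h+2\le k\le j+1$ (only if $j\ge h+1$).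
   Context: $\mathbb{N}$ denotes the non-negative integers, and $\langle r_0,\ldots,r_m\rangle=\mathbb{N}r_0+\cdots+\mathbb{N}r_m$ is the semigroup generated by $r_0,\ldots,r_m$. Empty products equal $1$. For a finite sequence $\Lambda=(r_0,\ldots,r_m)$ of positive integers put $d_i(\Lambda)=\gcd(r_0,\ldots,r_{i-1})$ for $1\le i\le m+1$, $n_i(\Lambda)=d_i(\Lambda)/d_{i+1}(\Lambda)$ for $1\le i\le m$, and $n_0(\Lambda)=1$. A sequence $\Delta=(\delta_0,\ldots,\delta_g)$ of positive integers with $g>0$ is a $\delta$-sequence if, with $d_i=d_i(\Delta)$ and $n_i=n_i(\Delta)$: (a) $d_{g+1}=1$ and $n_i>1$ for $1\le i\le g$; (b) $n_i\delta_i\in\langle\delta_0,\ldots,\delta_{i-1}\rangle$ for $1\le i\le g$; (c) $\delta_i<n_{i-1}\delta_{i-1}$ for $1\le i\le g$. By convention the one-term sequence $T=(1)$ is also a $\delta$-sequence (with $g=0$). For a $\delta$-sequence the numbers $a_i$ are positive integers with $a_0=1$ and $\gcd(a_i,n_i)=1$. A $\delta$-sequence $\Delta\neq T$ is principal if its second element divides its first element ($\delta_1\mid\delta_0$), and non-principal otherwise. In all parts the primed quantities refer to the sequence $\Delta'$ of length $g+2$ (so, for instance, in (b) $\delta_{j+1}'=\delta_j$, and in (c) $\delta_{j+1}'=\delta_j$ for $j\ge h$). Since $\Delta'$ contains all elements of $\Delta$, $\gcd$ of all its elements is $1$, so $\prod_{k=i+1}^{g+1}n_k'=d_{i+1}'$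 and $a_i'$ is a positive integer. *)

(* Defs.v *)
From mathcomp Require Import all_boot.

Set Implicit Arguments.
Unset Strict Implicit.
Unset Printing Implicit Defensive.

(* A sequence (r_0, ..., r_m) is a [seq nat] of size m + 1. *)

Definition in_semigroup (r : seq nat) (x : nat) : Prop :=
  exists c : nat -> nat, x = \sum_(0 <= k < size r) c k * nth 0 r k.

Definition same_semigroup (r s : seq nat) : Prop :=
  forall x : nat, in_semigroup r x <-> in_semigroup s x.

(* gcd (r_0, ..., r_{i-1}) *)
Definition d_ (r : seq nat) (i : nat) : nat :=
  \big[gcdn/0]_(0 <= k < i) nth 0 r k.

(* The division is exact: d_{i+1} divides d_i. *)
Definition n_ (r : seq nat) (i : nat) : nat :=
  if i == 0 then 1 else d_ r i %/ d_ r i.+1.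

(* r_i / prod_{k = i+1}^{m} n_k.  When the gcd of all elements of r is 1 and
   the elements are positive, the denominator is d_{i+1}, which divides r_i,
   so the division is exact. *)
Definition a_ (r : seq nat) (i : nat) : nat :=
  nth 0 r i %/ \prod_(i.+1 <= k < size r) n_ r k.

Definition delta_sequence (r : seq nat) : Prop :=
  r = [:: 1] \/
  exists g : nat,
    [/\ 0 < g /\ size r = g.+1,
        all (leq 1) r,
        d_ r g.+1 = 1 /\ (forall i, 1 <= i <= g -> 1 < n_ r i),
        forall i, 1 <= i <= g -> in_semigroup (take i r) (n_ r i * nth 0 r i) &
        forall i, 1 <= i <= g -> nth 0 r i < n_ r i.-1 * nth 0 r i.-1].

Definition principal_delta_sequence (r : seq nat) : Prop :=
  [/\ delta_sequence r, r <> [:: 1] & nth 0 r 1 %| nth 0 r 0].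

Definition nonprincipal_delta_sequence (r : seq nat) : Prop :=
  [/\ delta_sequence r, r <> [:: 1] & ~ (nth 0 r 1 %| nth 0 r 0)].

(* x_1 > x_2 > ... > x_p *)
Definition strictly_decreasing (s : seq nat) : bool := sorted gtn s.

(* Main.v *)
Require Import Defs.
From mathcomp Require Import all_boot.

(* Let r' be a delta-sequence r with beta inserted at position h. If r' is a
   delta-sequence and beta lies in the semigroup S of r, let j be the largest
   index occurring in a reduced expression of beta by r. Reducing this
   expression modulo d'_{j+1} shows that the coefficient of r_j is a multiple of
   n'_{j+1}, and then that beta = n'_{j+1} r_j with 1 < n'_{j+1} < n_j (beta is
   not a combination of the terms before h, or of r_0 when h = 0). Since
   d'_{k+1} = gcd(beta, d_k) for k >= h and gcd(a_j, n_j) = 1, for k <= j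
       d'_{k+1} = n'_{j+1} gcd(a_j, n_k ... n_{j-1}) d_{j+1},
   so the condition n'_{k+1} > 1 for k < j says that these gcds strictly
   decrease, while n'_{k+1} = n_k for k > j. Conversely, above position j + 2
   and below position h the axioms for r' reduce to those for r. *)

Set Implicit Arguments.
Unset Strict Implicit.
Unset Printing Implicit Defensive.

(** * Semigroups generated by finite sequences *)

Lemma in_semigroup_rcons r y x :
  in_semigroup (rcons r y) x <->
  exists z c, in_semigroup r z /\ x = z + c * y.
Proof.
have E c : \sum_(0 <= k < size r) c k * nth 0 (rcons r y) k
           = \sum_(0 <= k < size r) c k * nth 0 r k.
  by apply: eq_big_nat => k /andP[_ lt_k]; rewrite nth_rcons lt_k.
have ny : nth 0 (rcons r y) (size r) = y by rewrite nth_rcons ltnn eqxx.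
split=> [[c ->]|[z [c [[f ->] ->]]]].
  rewrite size_rcons big_nat_recr //= E ny.
  by exists (\sum_(0 <= k < size r) c k * nth 0 r k), (c (size r)); split=> //; exists c.
exists (fun k => if k < size r then f k else c).
rewrite size_rcons big_nat_recr //= ltnn ny; congr (_ + _).
by apply: eq_big_nat => k /andP[_ lt_k]; rewrite nth_rcons lt_k.
Qed.

Lemma in_semigroup0 r : in_semigroup r 0.
Proof. by exists (fun=> 0); rewrite big1. Qed.

Lemma in_semigroupD r x y :
  in_semigroup r x -> in_semigroup r y -> in_semigroup r (x + y).
Proof.
move=> [c ->] [f ->]; exists (fun k => c k + f k).
by rewrite -big_split /=; apply: eq_bigr => k _; rewrite mulnDl.
Qed.

Lemma in_semigroupM r m x : in_semigroup r x -> in_semigroup r (m * x).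
Proof.
move=> rx; elim: m => [|m IHm]; first exact: in_semigroup0.
by rewrite mulSn; apply: in_semigroupD.
Qed.

Lemma mem_in_semigroup r x : x \in r -> in_semigroup r x.
Proof.
(* The coefficients are the indicator of the first occurrence of [x], booleans being read as 0 and
   1. *)
move=> rx; exists (fun k => k == index x r).
rewrite (bigD1_seq (index x r)) ?iota_uniq ?mem_index_iota ?index_mem //=.
by rewrite eqxx mul1n nth_index // big1 ?addn0 // => k /negPf->.
Qed.

(* A generator larger than [x] cannot occur in an expression of [x], so only
   the generators [y <= x] have to be checked. *)
Lemma in_semigroup_sub r s x :
  in_semigroup r x ->
  {in r, forall y, y <= x -> in_semigroup s y} -> in_semigroup s x.
Proof.
move=> rx; elim/last_ind: r x rx => [|r y IHr] x.
  by case=> c ->; rewrite big_geq // => _; apply: in_semigroup0.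
case/in_semigroup_rcons => z [c [rz ->]] rs; apply: in_semigroupD.
  apply: IHr => // w rw le_wz; apply: rs; first by rewrite mem_rcons inE rw orbT.
  by rewrite (leq_trans le_wz) ?leq_addr.
case: c rs => [|c] rs; first exact: in_semigroup0.
apply/in_semigroupM/rs; first by rewrite mem_rcons mem_head.
by rewrite mulSn addnCA leq_addr.
Qed.

Lemma in_semigroup_subset r s x :
  {subset r <= s} -> in_semigroup r x -> in_semigroup s x.
Proof. by move=> rs /in_semigroup_sub; apply=> y /rs /mem_in_semigroup. Qed.

Lemma dvdn_in_semigroup m r x :
  {in r, forall y, m %| y} -> in_semigroup r x -> m %| x.
Proof.
move=> rm [c ->]; rewrite big_nat; apply: dvdn_sum => k /andP[_ lt_k].
by rewrite dvdn_mull // rm // mem_nth.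
Qed.

Lemma subset_take (r : seq nat) i j : i <= j -> {subset take i r <= take j r}.
Proof. by move=> le_ij x; rewrite -(subnKC le_ij) takeD mem_cat => ->. Qed.

(** * The gcds d_i, the quotients n_i and the reduced terms a_i *)

Lemma d_S r i : d_ r i.+1 = gcdn (d_ r i) (nth 0 r i).
Proof. by rewrite /d_ big_nat_recr. Qed.

Lemma dvdn_d_S r i : d_ r i.+1 %| d_ r i.
Proof. by rewrite d_S dvdn_gcdl. Qed.

Lemma dvdn_d_nth r i j : i < j -> d_ r j %| nth 0 r i.
Proof.
elim: j => // j IHj; rewrite ltnS leq_eqVlt => /predU1P[->|/IHj].
  by rewrite d_S dvdn_gcdr.
exact/dvdn_trans/dvdn_d_S.
Qed.

Lemma dvdn_d_in_semigroup r i x : in_semigroup (take i r) x -> d_ r i %| x.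
Proof.
apply: dvdn_in_semigroup => y /(nthP 0)[k]; rewrite size_take_min leq_min.
by case/andP=> lt_ki _ <-; rewrite nth_take // dvdn_d_nth.
Qed.

Lemma n_mul_d r i : 0 < i -> n_ r i * d_ r i.+1 = d_ r i.
Proof. by case: i => // i _; rewrite /n_ /= divnK ?dvdn_d_S. Qed.

Lemma prod_n_mul_d r i j :
  0 < i <= j -> (\prod_(i <= k < j) n_ r k) * d_ r j = d_ r i.
Proof.
case/andP=> i_gt0; elim: j => [|j IHj]; first by rewrite leqNgt i_gt0.
rewrite leq_eqVlt => /predU1P[<-|lt_ij]; first by rewrite big_geq ?mul1n.
by rewrite big_nat_recr //= -mulnA n_mul_d ?IHj // (leq_trans i_gt0).
Qed.

Lemma dvdn_d_le r i j : i <= j -> d_ r j %| d_ r i.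
Proof.
elim: j => [|j IHj]; first by rewrite leqn0 => /eqP->.
rewrite leq_eqVlt => /predU1P[->//|/IHj]; exact/dvdn_trans/dvdn_d_S.
Qed.

Lemma d_gt0 r i : all (leq 1) r -> 0 < i -> 0 < size r -> 0 < d_ r i.
Proof.
move=> /allP r_gt0 i_gt0 sz; have /dvdn_gt0 := @dvdn_d_nth r 0 i i_gt0.
by apply; rewrite r_gt0 ?mem_nth.
Qed.

Lemma a_mul_d r i :
  d_ r (size r) = 1 -> i < size r -> a_ r i * d_ r i.+1 = nth 0 r i.
Proof.
move=> d1 lt_i; have := @prod_n_mul_d r i.+1 (size r) lt_i.
by rewrite d1 muln1 /a_ => ->; rewrite divnK ?dvdn_d_nth.
Qed.

(** Dividing gcd(d_i, r_i) = d_{i+1} by d_{i+1} leaves gcd(n_i, a_i) = 1. *)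
Lemma coprime_a_n r i :
    all (leq 1) r -> d_ r (size r) = 1 -> 0 < i < size r ->
  coprime (a_ r i) (n_ r i).
Proof.
move=> r_gt0 d1 /andP[i_gt0 lt_i].
have d_pos : 0 < d_ r i.+1 by rewrite d_gt0 // (leq_trans _ lt_i).
have := d_S r i; rewrite -{1}(a_mul_d d1 lt_i) -(n_mul_d r i_gt0) -muln_gcdl.
by rewrite gcdnC -{1}[d_ r i.+1]mul1n => /eqP; rewrite eqn_pmul2r // eq_sym.
Qed.

(** Cancelling d_{i+1} turns the hypothesis into n_i | c q with q = r_i / d_{i+1} coprime to n_i. *)
Lemma n_dvd r i c :
  0 < i -> 0 < d_ r i.+1 -> d_ r i %| c * nth 0 r i -> n_ r i %| c.
Proof.
move=> i_gt0 d_pos; have /dvdnP[q Eq] := @dvdn_d_nth r i i.+1 (ltnSn i).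
rewrite -(n_mul_d r i_gt0) Eq mulnA dvdn_pmul2r // Gauss_dvdl //.
have := d_S r i; rewrite Eq -(n_mul_d r i_gt0) -muln_gcdl.
by rewrite -{1}[d_ r i.+1]mul1n => /eqP; rewrite eqn_pmul2r // eq_sym.
Qed.

(** A known length removes the disjunction: for g = 0 the ranges of i are empty, and d_1 = 1 forces
    the sequence (1). *)
Lemma delta_sequenceP r g : size r = g.+1 ->
  delta_sequence r <->
  [/\ all (leq 1) r, d_ r g.+1 = 1,
      forall i, 1 <= i <= g -> 1 < n_ r i,
      forall i, 1 <= i <= g -> in_semigroup (take i r) (n_ r i * nth 0 r i) &
      forall i, 1 <= i <= g -> nth 0 r i < n_ r i.-1 * nth 0 r i.-1].
Proof.
move=> szr; split=> [[E|[g' [[_ Eg] r_gt0 [d1 n1] Hs Hl]]]|[r_gt0 d1 n1 Hs Hl]].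
- have g0 : g = 0 by move: szr; rewrite E => -[].
  have F i : 1 <= i <= 0 -> False by case: i.
  by rewrite g0 E; split=> [||i /F|i /F|i /F] //; rewrite /d_ big_nat1.
- by have -> : g = g' by [apply: succn_inj; rewrite -szr].
case: (posnP g) => [g0|g_gt0]; last by right; exists g.
left; move: szr d1; rewrite g0 /d_ big_nat1.
by case: r {r_gt0 n1 Hs Hl} => [|x [|y r]] //= _ ->.
Qed.

(** * Insertion of one term into a sequence *)

Definition insert_at (h beta : nat) (r : seq nat) : seq nat :=
  take h r ++ beta :: drop h r.

Lemma size_insert_at h beta r : size (insert_at h beta r) = (size r).+1.
Proof. by rewrite size_cat /= addnS -size_cat cat_take_drop. Qed.

Lemma mem_insert_at h beta r : insert_at h beta r =i beta :: r.
Proof.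
move=> x; rewrite mem_cat inE -[in RHS](cat_take_drop h r) !inE mem_cat.
by rewrite orbCA.
Qed.

Lemma nth_insert_at_lt h beta r k :
  h <= size r -> k < h -> nth 0 (insert_at h beta r) k = nth 0 r k.
Proof. by move=> le_h lt_k; rewrite nth_cat size_takel // lt_k nth_take. Qed.

Lemma nth_insert_at_eq h beta r :
  h <= size r -> nth 0 (insert_at h beta r) h = beta.
Proof. by move=> le_h; rewrite nth_cat size_takel // ltnn subnn. Qed.

Lemma nth_insert_at_gt h beta r k :
  h <= size r -> h <= k -> nth 0 (insert_at h beta r) k.+1 = nth 0 r k.
Proof.
move=> le_h le_k; rewrite nth_cat size_takel // ltnNge leqW //= subSn //=.
by rewrite nth_drop subnKC.
Qed.

Lemma take_insert_at_le h beta r k :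
  h <= size r -> k <= h -> take k (insert_at h beta r) = take k r.
Proof. by move=> le_h le_k; rewrite takel_cat ?size_takel // take_takel. Qed.

Lemma take_insert_at_gt h beta r k :
    h <= size r -> h <= k ->
  take k.+1 (insert_at h beta r) = insert_at h beta (take k r).
Proof.
move=> le_h le_k; rewrite take_cat size_takel // ltnNge leqW //= subSn //=.
by rewrite take_drop subnK // /insert_at take_takel.
Qed.

Lemma d_insert_at_le h beta r k :
  h <= size r -> k <= h -> d_ (insert_at h beta r) k = d_ r k.
Proof.
move=> le_h le_k; apply: eq_big_nat => i /andP[_ lt_i].
by rewrite nth_insert_at_lt // (leq_trans lt_i).
Qed.

(** From position h on, beta is one more argument of the gcd. For h = k = 0 the empty gcd is 0 and
    the formula gives d'_1 = beta, so prepending fits the same scheme. *)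
Lemma d_insert_at_gt h beta r k :
    h <= size r -> h <= k ->
  d_ (insert_at h beta r) k.+1 = gcdn beta (d_ r k).
Proof.
move=> le_h; elim: k => [|k IHk].
  rewrite leqn0 => /eqP h0; subst h.
  by rewrite d_S d_insert_at_le // nth_insert_at_eq // gcdnC.
rewrite leq_eqVlt => /predU1P[h_eq|le_k].
  by rewrite d_S d_insert_at_le -?h_eq // nth_insert_at_eq // gcdnC.
by rewrite d_S IHk // nth_insert_at_gt // -gcdnA -d_S.
Qed.

Lemma n_insert_at_lt h beta r k :
  h <= size r -> k < h -> n_ (insert_at h beta r) k = n_ r k.
Proof. by move=> le_h lt_k; rewrite /n_ !d_insert_at_le // ltnW. Qed.

(** If d_k divides beta, so does d_{k+1}; taking the gcd with beta then changes neither of them. *)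
Lemma n_insert_at_gt h beta r k :
    h <= size r -> h <= k -> 0 < k -> d_ r k %| beta ->
  n_ (insert_at h beta r) k.+1 = n_ r k.
Proof.
move=> le_h le_k k_gt0 dv; rewrite /n_ /= -[k in k == 0](prednK k_gt0) /=.
rewrite !d_insert_at_gt ?(leqW le_k) //.
by rewrite !(gcdn_idPr _) // (dvdn_trans (dvdn_d_S _ _)).
Qed.

(** After clearing denominators the claim is that gcd(beta, d_k) d_{k+1} divides d_k gcd(beta,
    d_{k+1}), which is checked on both arguments of the last gcd. *)
Lemma n_insert_at_dvdn h beta r k :
    h <= size r -> h <= k -> 0 < k -> 0 < d_ r k.+1 ->
  n_ (insert_at h beta r) k.+1 %| n_ r k.
Proof.
move=> le_h le_k k_gt0 d_pos; set r' := insert_at h beta r.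
have d'E i : h <= i -> d_ r' i.+1 = gcdn beta (d_ r i) by exact: d_insert_at_gt.
have d'_pos : 0 < d_ r' k.+2 by rewrite d'E ?leqW // gcdn_gt0 d_pos orbT.
rewrite -(dvdn_pmul2r d'_pos) n_mul_d // -(dvdn_pmul2r d_pos).
rewrite mulnAC (n_mul_d r k_gt0) !d'E ?leqW // muln_gcdr dvdn_gcd.
by rewrite [d_ r k * beta]mulnC !dvdn_mul ?dvdn_gcdl ?dvdn_gcdr ?dvdn_d_S.
Qed.

(** * Reduced expressions and the value of the inserted term *)

(** Descent on the last generator: its coefficient is reduced modulo n. A zero remainder removes the
    generator, a nonzero one makes it the wanted r_j. The descent stops at some j >= p, since the
    first p terms do not generate x. *)
Lemma take_decomp r g x m p :
    size r = g.+1 -> delta_sequence r -> 0 < p -> m <= g ->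
    in_semigroup (take m.+1 r) x -> ~ in_semigroup (take p r) x ->
  exists j c y, [/\ p <= j <= m, 0 < c < n_ r j, in_semigroup (take j r) y
                  & x = y + c * nth 0 r j].
Proof.
move=> szr /(delta_sequenceP szr)[r_gt0 d1 n1 Hs Hl] p_gt0.
elim: m => [|m IHm] le_m rx not_rx.
  by case: not_rx; apply: in_semigroup_subset rx; apply: subset_take.
case: (leqP p m.+1) => [le_p|lt_mp]; last first.
  by case: not_rx; apply: in_semigroup_subset rx; apply: subset_take.
move: (rx); rewrite (take_nth 0) ?szr // => /in_semigroup_rcons[z [c [rz x_eq]]].
set n := n_ r m.+1; have n_gt0 : 0 < n by rewrite ltnW // n1.
(* By axiom (b) the part of c divisible by n can be moved into the earlier generators. *)
set y := z + (c %/ n) * (n * nth 0 r m.+1).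
have ry : in_semigroup (take m.+1 r) y.
  by apply/in_semigroupD/in_semigroupM/Hs.
have x_eq' : x = y + (c %% n) * nth 0 r m.+1.
  by rewrite /y x_eq {1}(divn_eq c n) mulnDl addnA mulnA.
case: (posnP (c %% n)) => [c0|c_gt0].
  have rx' : in_semigroup (take m.+1 r) x by rewrite x_eq' c0 addn0.
  have [j [c' [y' [/andP[pj jm] ? ? ?]]]] := IHm (ltnW le_m) rx' not_rx.
  by exists j, c', y'; rewrite pj leqW.
by exists m.+1, (c %% n), y; rewrite le_p leqnn c_gt0 ltn_pmod.
Qed.

(* Equality holds: were [n'_{j+1} * r_j < beta], the axiom for r' would put it
   in <r_0, ..., r_{j-1}>, forcing [n_j] to divide the smaller [n'_{j+1}]. *)
Lemma inserted_eq r g h beta :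
    let r' := insert_at h beta r in
    size r = g.+1 -> delta_sequence r -> h <= g.+1 -> delta_sequence r' ->
    in_semigroup r beta -> ~ in_semigroup (take (maxn h 1) r) beta ->
  exists j, [/\ h <= j, 1 <= j <= g, beta = n_ r' j.+1 * nth 0 r j
              & 1 < n_ r' j.+1 < n_ r j].
Proof.
move=> r' szr dr le_h dr' rb not_rb.
have szr' : size r' = g.+2 by rewrite size_insert_at szr.
have [r_gt0 _ _ Hs _] := (delta_sequenceP szr).1 dr.
have [r'_gt0 _ n'1 Hs' _] := (delta_sequenceP szr').1 dr'.
have rb' : in_semigroup (take g.+1 r) beta by rewrite take_oversize ?szr.
(* The maximum makes j positive even for h = 0, where the excluded elements are the multiples of
   r_0. *)
have p_gt0 : 0 < maxn h 1 by rewrite leq_max orbT.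
have [j [c [y [/andP[]]]]] := take_decomp szr dr p_gt0 (leqnn g) rb' not_rb.
rewrite geq_max => /andP[le_hj j_gt0] le_jg /andP[c_gt0 lt_c] ry b_eq.
have szh : h <= size r by rewrite szr.
have n'_gt1 : 1 < n_ r' j.+1 by rewrite n'1.
have tE : take j.+1 r' = insert_at h beta (take j r) by rewrite take_insert_at_gt.
(* Both beta and y are divisible by d'_{j+1}, as beta and the generators of y precede r_j in r';
   hence so is c r_j. *)
have n'c : n_ r' j.+1 %| c.
  apply: n_dvd => //; first by rewrite d_gt0 ?szr'.
  have b_dvd : d_ r' j.+1 %| beta by rewrite d_insert_at_gt // dvdn_gcdl.
  have y_dvd : d_ r' j.+1 %| y.
    apply: dvdn_d_in_semigroup; rewrite tE; apply: in_semigroup_subset ry => x rx.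
    by rewrite mem_insert_at inE rx orbT.
  by rewrite /r' nth_insert_at_gt // -(dvdn_addr _ y_dvd) -b_eq.
have le_n' : n_ r' j.+1 <= c by rewrite dvdn_leq.
have lt_n' : n_ r' j.+1 < n_ r j by apply: leq_ltn_trans lt_c.
have le_b : n_ r' j.+1 * nth 0 r j <= beta.
  by rewrite b_eq (leq_trans _ (leq_addl _ _)) // leq_mul2r le_n' orbT.
exists j; split; rewrite ?j_gt0 ?n'_gt1 //.
apply/eqP; rewrite eqn_leq le_b andbT leqNgt; apply/negP => lt_b.
have := Hs' j.+1 le_jg; rewrite tE [nth 0 r' _]nth_insert_at_gt // => Hj.
have rj : in_semigroup (take j r) (n_ r' j.+1 * nth 0 r j).
  apply: in_semigroup_sub Hj _ => x; rewrite mem_insert_at inE.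
  case/predU1P=> [->|rx _]; last exact: mem_in_semigroup.
  by rewrite leqNgt lt_b.
have /dvdn_leq : n_ r j %| n_ r' j.+1.
  by apply: n_dvd => //; [rewrite d_gt0 ?szr | apply: dvdn_d_in_semigroup].
by move/(_ (ltnW n'_gt1)); rewrite leqNgt lt_n'.
Qed.

(** * The gcds of the extended sequence *)

Lemma inserted_coef_dvdn r g h beta j (e := n_ (insert_at h beta r) j.+1) :
    size r = g.+1 -> delta_sequence r -> h <= j -> 1 <= j <= g ->
    beta = e * nth 0 r j ->
  e %| n_ r j.
Proof.
move=> szr dr le_hj /andP[j_gt0 le_jg] b_eq.
have [r_gt0 _ _ _ _] := (delta_sequenceP szr).1 dr.
apply: n_insert_at_dvdn => //; last by rewrite d_gt0 ?szr.
by rewrite szr (leq_trans le_hj) // leqW.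
Qed.

(** Here beta = e a_j d_{j+1} and d_k = n_k ... n_{j-1} n_j d_{j+1}. As e divides n_j, it comes out
    of the gcd; the cofactor n_j / e drops out because it is coprime to a_j. *)
Lemma d_inserted r g h beta j k (e := n_ (insert_at h beta r) j.+1) :
    size r = g.+1 -> delta_sequence r -> h <= j -> 1 <= j <= g ->
    beta = e * nth 0 r j -> 1 <= k <= j ->
  gcdn beta (d_ r k) =
    e * gcdn (a_ r j) (\prod_(k <= i < j) n_ r i) * d_ r j.+1.
Proof.
move=> szr dr le_hj /andP[j_gt0 le_jg] b_eq /andP[k_gt0 le_kj].
have [r_gt0 d1 _ _ _] := (delta_sequenceP szr).1 dr.
have /dvdnP[q nj] : e %| n_ r j.
  by apply: inserted_coef_dvdn szr dr _ _ b_eq; rewrite ?j_gt0.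
have cop : coprime (a_ r j) (n_ r j) by apply: coprime_a_n; rewrite ?szr // j_gt0.
rewrite b_eq -(a_mul_d (r := r)) ?szr // mulnA.
rewrite -(@prod_n_mul_d r k j) ?k_gt0 // -(n_mul_d r j_gt0) mulnA -muln_gcdl.
congr (_ * _); rewrite nj mulnA [_ * e]mulnC -muln_gcdr Gauss_gcdl //.
by move: cop; rewrite nj coprimeMr => /andP[].
Qed.

(** In n'_{k+1} d'_{k+2} = d'_{k+1} both gcds are given by [d_inserted], and their common factor
    n'_{j+1} d_{j+1} cancels. *)
Lemma n_mul_gcd r g h beta j k (r' := insert_at h beta r) :
    size r = g.+1 -> delta_sequence r -> h <= j -> 1 <= j <= g ->
    beta = n_ r' j.+1 * nth 0 r j -> 0 < beta -> h <= k -> 1 <= k < j ->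
  n_ r' k.+1 * gcdn (a_ r j) (\prod_(k.+1 <= i < j) n_ r i) =
  gcdn (a_ r j) (\prod_(k <= i < j) n_ r i).
Proof.
move=> szr dr le_hj lt_j b_eq b_gt0 le_hk /andP[k_gt0 lt_kj].
have [r_gt0 _ _ _ _] := (delta_sequenceP szr).1 dr.
have [j_gt0 le_jg] := andP lt_j.
have szh : h <= size r by rewrite szr (leq_trans le_hj) // leqW.
have := n_mul_d r' (ltn0Sn k).
rewrite !d_insert_at_gt ?leqW // !(d_inserted szr dr le_hj lt_j b_eq) ?k_gt0 //.
  rewrite mulnA [n_ r' k.+1 * _]mulnCA => /eqP.
  rewrite eqn_pmul2r ?d_gt0 ?szr // eqn_pmul2l; first by move/eqP.
  by move: b_gt0; rewrite {1}b_eq muln_gt0 => /andP[].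
exact: ltnW.
Qed.

(* The last term [1] of the chain is the value at [l = j] of the gcd, whose
   product is empty there. *)
Lemma rcons_gcd_chain r j h :
  h <= j ->
  rcons [seq gcdn (a_ r j) (\prod_(l <= k < j) n_ r k) | l <- index_iota h j] 1
  = [seq gcdn (a_ r j) (\prod_(l <= k < j) n_ r k) | l <- index_iota h j.+1].
Proof.
move=> le_hj; rewrite /index_iota subSn // -[(j - h).+1]addn1 iotaD map_cat /= subnKC //.
by rewrite cats1 big_geq // gcdn1.
Qed.

Lemma sorted_gtn_map (f : nat -> nat) a n :
  (forall k, a <= k < a + n -> f k.+1 < f k) ->
  sorted gtn [seq f l | l <- iota a n.+1].
Proof.
elim: n a => [|n IHn] a //= Hf; rewrite Hf ?leqnn ?addnS ?ltnS ?leq_addr //=.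
by apply: (IHn a.+1) => k /andP[lt_k lt]; rewrite Hf // ltnW //= -addSnnS.
Qed.

(** * Preservation of the semigroup and of the axioms *)

Lemma same_semigroup_insert_at h beta r :
  in_semigroup r beta -> same_semigroup (insert_at h beta r) r.
Proof.
move=> rb x; split=> [r'x|]; last first.
  by apply: in_semigroup_subset => y ry; rewrite mem_insert_at inE ry orbT.
apply: in_semigroup_sub r'x _ => y; rewrite mem_insert_at inE.
by case/predU1P=> [->//|ry _]; apply: mem_in_semigroup.
Qed.

Lemma in_semigroup_same_insert_at h beta r :
  same_semigroup (insert_at h beta r) r -> in_semigroup r beta.
Proof.
by move=> S; apply/S/mem_in_semigroup; rewrite mem_insert_at mem_head.
Qed.

(** For k > j, d_k divides r_j and therefore its multiple beta. *)
Lemma n_insert_at_after r h beta j c k :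
    h <= size r -> h <= j -> beta = c * nth 0 r j -> j < k ->
  n_ (insert_at h beta r) k.+1 = n_ r k.
Proof.
move=> le_h le_hj b_eq lt_jk; have le_hk := leq_trans le_hj (ltnW lt_jk).
by rewrite n_insert_at_gt // ?(leq_trans _ lt_jk) // b_eq dvdn_mull ?dvdn_d_nth.
Qed.

(** Before h nothing changes; after j+1 the quotients are the old ones and the prefixes only gain
    the generator beta. So the axioms are checked from h to j+1 only, except that (c) at i involves
    n'_{i-1} and has to be checked up to j+2. *)
Lemma delta_sequence_insert_at r g h beta j c (r' := insert_at h beta r) :
    size r = g.+1 -> delta_sequence r -> 0 < beta -> h <= j <= g ->
    beta = c * nth 0 r j ->
    (forall i, 0 < i -> h <= i <= j.+1 -> 1 < n_ r' i) ->
    (forall i, 0 < i -> h <= i <= j.+1 ->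
       in_semigroup (take i r') (n_ r' i * nth 0 r' i)) ->
    (forall i, 0 < i -> h <= i <= minn j.+2 g.+1 ->
       nth 0 r' i < n_ r' i.-1 * nth 0 r' i.-1) ->
  delta_sequence r' /\ same_semigroup r' r.
Proof.
move=> szr dr b_gt0 /andP[le_hj le_jg] b_eq n'1 Hs' Hl'.
have [r_gt0 d1 n1 Hs Hl] := (delta_sequenceP szr).1 dr.
have szr' : size r' = g.+2 by rewrite size_insert_at szr.
have szh : h <= size r by rewrite szr (leq_trans le_hj) // leqW.
have n'after k : j < k -> n_ r' k.+1 = n_ r k.
  exact: n_insert_at_after szh le_hj b_eq.
have n'before k : k < h -> n_ r' k = n_ r k by apply: n_insert_at_lt.
have r'after k : h <= k -> nth 0 r' k.+1 = nth 0 r k by apply: nth_insert_at_gt.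
have r'before k : k < h -> nth 0 r' k = nth 0 r k by apply: nth_insert_at_lt.
split; last first.
  apply: same_semigroup_insert_at; rewrite b_eq; apply/in_semigroupM.
  by apply: mem_in_semigroup; rewrite mem_nth ?szr.
apply/(delta_sequenceP szr').
have cases i : 1 <= i <= g.+1 ->
    [\/ i < h /\ 1 <= i <= g, 0 < i /\ h <= i <= j.+1 |
      exists k, [/\ i = k.+1, j < k & 1 <= k <= g]].
  case: i => //= i le_ig; case: (ltnP i.+1 h) => [lt_ih|le_hi].
    by constructor 1; rewrite (leq_trans _ (leq_trans le_hj le_jg)) // ltnW.
  case: (leqP i j) => [le_ij|lt_ji]; first by constructor 2.
  by constructor 3; exists i; split; rewrite // -[i <= g]ltnS le_ig (leq_ltn_trans _ lt_ji).
split.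
- apply/allP => x; rewrite mem_insert_at inE => /predU1P[->//|].
  exact: (allP r_gt0).
- by rewrite d_insert_at_gt ?d1 ?gcdn1 // (leq_trans le_hj) // leqW.
- move=> i /cases[[lt_i le_i]|[i_gt0 le_i]|[k [-> lt_k le_k]]].
  + by rewrite n'before ?n1.
  + exact: n'1.
  + by rewrite n'after ?n1.
- move=> i /cases[[lt_i le_i]|[i_gt0 le_i]|[k [-> lt_k le_k]]].
  + by rewrite n'before // r'before // take_insert_at_le ?(ltnW lt_i) //; apply: Hs.
  + exact: Hs'.
  + have le_hk : h <= k by apply: leq_trans (ltnW lt_k).
    rewrite n'after // r'after // take_insert_at_gt //.
    apply: in_semigroup_subset (Hs k le_k) => x rx.
    by rewrite mem_insert_at inE rx orbT.
move=> i le_i; case: (leqP i (minn j.+2 g.+1)) => [le_im|].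
  case: (leqP h i) => [le_hi|lt_ih]; first by apply: Hl'; rewrite ?le_hi //; case/andP: le_i.
  have lt_ih' : i.-1 < h by rewrite (leq_ltn_trans (leq_pred i)).
  rewrite n'before // !r'before //; apply: Hl; case/andP: le_i => -> _.
  by rewrite -ltnS (leq_trans lt_ih) // (leq_trans le_hj) // leqW.
have [i_gt0 le_ig] := andP le_i; rewrite gtn_min [g.+1 < i]ltnNge le_ig orbF.
case: i i_gt0 le_ig {le_i} => // -[|i] // _ le_ig lt_ji.
(* The position is i+2 with i > j, so n'_{i+1} = n_i and the claim is axiom (c) for r at i+1. *)
have le_hi : h <= i by rewrite (leq_trans le_hj) // ltnW.
by rewrite [i.+2.-1]/= n'after // !r'after ?leqW //; apply: (Hl i.+1).
Qed.

Lemma insert_at0 beta r : insert_at 0 beta r = beta :: r.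
Proof. by rewrite /insert_at take0 drop0. Qed.

Lemma nth_eq_a_prod r j :
    d_ r (size r) = 1 -> j < size r ->
  nth 0 r j = a_ r j * \prod_(j.+1 <= k < size r) n_ r k.
Proof.
move=> d1 lt_j; rewrite -(a_mul_d d1 lt_j).
by rewrite -(@prod_n_mul_d r j.+1 (size r) lt_j) d1 muln1.
Qed.

Lemma d0E r : d_ r 0 = 0.
Proof. by rewrite /d_ big_geq. Qed.

Lemma d1E r : d_ r 1 = nth 0 r 0.
Proof. by rewrite /d_ big_nat1. Qed.

(** By [n_mul_gcd] consecutive terms have ratio n'_{k+1} > 1. The start p is kept apart from h
    because prepending has h = 0 and a chain starting at 1. *)
Lemma sorted_gcd_chain r g h p beta j (r' := insert_at h beta r) :
    size r = g.+1 -> delta_sequence r -> h <= p -> 0 < p <= j -> j <= g ->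
    beta = n_ r' j.+1 * nth 0 r j -> 0 < beta ->
    (forall i, p <= i <= j -> 1 < n_ r' i.+1) ->
  sorted gtn
    (rcons [seq gcdn (a_ r j) (\prod_(l <= k < j) n_ r k) | l <- index_iota p j]
           1).
Proof.
move=> szr dr le_hp /andP[p_gt0 le_pj] le_jg b_eq b_gt0 n'1.
have [r_gt0 d1 _ _ _] := (delta_sequenceP szr).1 dr.
have le_hj := leq_trans le_hp le_pj; have j_gt0 := leq_trans p_gt0 le_pj.
rewrite rcons_gcd_chain // /index_iota subSn //; apply: sorted_gtn_map => k.
rewrite subnKC // => /andP[le_pk lt_kj].
rewrite -(@n_mul_gcd r g h beta j k) ?j_gt0 ?lt_kj ?(leq_trans le_hp) //;
  last by rewrite andbT (leq_trans p_gt0).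
rewrite ltn_Pmull ?n'1 ?le_pk ?(ltnW lt_kj) // gcdn_gt0.
have : 0 < nth 0 r j by apply: (allP r_gt0); rewrite mem_nth ?szr.
by rewrite -(a_mul_d (r := r)) ?szr // muln_gt0 => /andP[->].
Qed.

(** * Insertion in front: the principal case *)

Lemma principal_insertion g r beta (r' := beta :: r) :
    size r = g.+1 -> delta_sequence r -> all (leq 1) r' ->
  principal_delta_sequence r' /\ same_semigroup r' r <->
  exists alpha, 1 < alpha /\ beta = alpha * nth 0 r 0.
Proof.
move=> szr dr; have r'E : r' = insert_at 0 beta r by rewrite insert_at0.
have szr' : size r' = g.+2 by rewrite /= szr.
have [r_gt0 d1 n1 Hs Hl] := (delta_sequenceP szr).1 dr.
have r0_gt0 : 0 < nth 0 r 0 by apply: (allP r_gt0); rewrite mem_nth ?szr.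
move=> /= /andP[b_gt0 _]; split=> [[[dr' _ dvd] _]|[alpha [alpha_gt1 b_eq]]].
  have [_ _ _ _ Hl'] := (delta_sequenceP szr').1 dr'.
  exists (beta %/ nth 0 r 0); rewrite divnK //; split=> //.
  rewrite -(ltn_pmul2r r0_gt0) divnK // mul1n.
  by have := Hl' 1 isT; rewrite /= mul1n.
(* Here d'_1 = beta, and d'_2 = gcd(beta, r_0) = r_0. *)
have n'1 : n_ r' 1 = alpha.
  by rewrite /n_ /= r'E !d_insert_at_gt // d0E gcdn0 d1E b_eq gcdnC gcdnMl mulnK.
(* The criterion is applied with h = j = 0, beta being a multiple of r_0. *)
have [i i_gt0|i i_gt0|i i_gt0|dr' S] :=
    @delta_sequence_insert_at r g 0 beta 0 alpha szr dr b_gt0 isT b_eq.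
- by case: i i_gt0 => [|[]] // _ _; rewrite -r'E n'1.
- case: i i_gt0 => [|[]] // _ _; rewrite -r'E n'1 /= take0 -b_eq.
  by apply: mem_in_semigroup; rewrite mem_head.
- rewrite -r'E; case: i i_gt0 => [|[|[|i]]] // _; rewrite leq_min //= => H.
    by rewrite mul1n b_eq ltn_Pmull.
  rewrite n'1; have /Hl : 1 <= 1 <= g by [].
  by rewrite /= mul1n => /leq_trans; apply; rewrite leq_pmull // ltnW.
rewrite r'E; do !split=> //; last by rewrite -r'E /= b_eq dvdn_mull.
by move/(congr1 size); rewrite size_insert_at szr.
Qed.

(** * Insertion in front: the non-principal case *)

Lemma nonprincipal_insertion g r beta (r' := beta :: r) :
    size r = g.+1 -> delta_sequence r -> all (leq 1) r' ->
  nonprincipal_delta_sequence r' /\ same_semigroup r' r <->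
  exists j : nat, 1 <= j <= g /\
       [/\ beta = n_ r' j.+1 * nth 0 r' j.+1
           /\ beta = n_ r' j.+1 * a_ r j * \prod_(j.+1 <= k < g.+1) n_ r k,

           (j = 1 ->
             [/\ forall k, 2 <= k <= g -> n_ r' k.+1 = n_ r k,
                 n_ r 1 = a_ r' 1 * n_ r' 2,
                 1 < a_ r' 1 /\ 1 < n_ r' 2,
                 n_ r' 1 %| a_ r 1 &
                 a_ r' 1 < n_ r' 1 /\ gcdn (a_ r' 1) (n_ r' 1) = 1]),

           (2 <= j ->
             [/\ strictly_decreasing
                   (rcons [seq gcdn (a_ r j) (\prod_(l <= k < j) n_ r k)
                          | l <- index_iota 1 j] 1),
                 n_ r' 1 %| a_ r j /\ 1 < n_ r' 1 < a_ r j,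
                 forall k, 1 <= k <= j -> n_ r' k.+1 %| n_ r k /\ 1 < n_ r' k.+1,
                 exists k0, 1 <= k0 <= j /\ n_ r' k0.+1 <> n_ r k0 &
                 forall k, j.+1 <= k <= g -> n_ r' k.+1 = n_ r k]),

           beta > nth 0 r 0
           /\ (forall k, 2 <= k <= minn j.+1 g ->
                 nth 0 r k < n_ r' k * nth 0 r k.-1) &

           beta %| n_ r' 1 * nth 0 r 0
           /\ (forall k, 1 <= k <= j ->
                 in_semigroup (beta :: take k r) (n_ r' k.+1 * nth 0 r k))].
Proof.
move=> szr dr; have r'E : r' = insert_at 0 beta r by rewrite insert_at0.
have szr' : size r' = g.+2 by rewrite /= szr.
have [r_gt0 d1 n1 Hs Hl] := (delta_sequenceP szr).1 dr.
have r0_gt0 : 0 < nth 0 r 0 by apply: (allP r_gt0); rewrite mem_nth ?szr.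
move=> r'_gt0; have b_gt0 : 0 < beta by case/andP: r'_gt0.
have d'E k : d_ r' k.+1 = gcdn beta (d_ r k) by rewrite r'E d_insert_at_gt.
have d'1 : d_ r' 1 = beta by rewrite d1E.
have a'1 : a_ r' 1 * d_ r' 2 = nth 0 r 0.
  by apply: (a_mul_d (r := r')); rewrite szr' // d'E d1 gcdn1.
have d'2_gt0 : 0 < d_ r' 2 by rewrite d'E gcdn_gt0 b_gt0.
split=> [[[dr' _ ndvd] S]|[j [le_j [[b_eq _] H1 H2 [lt_b Hl'] [Hd Hs']]]]].
  have [_ _ n'1 Hs' Hl'] := (delta_sequenceP szr').1 dr'.
  have [|||j [_ le_j]] := @inserted_eq r g 0 beta szr dr isT.
  - by rewrite -r'E.
  - by apply: (@in_semigroup_same_insert_at 0); rewrite -r'E.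
  (* The prefix here is (r_0), so membership would make beta a multiple of r_0. *)
  - move=> /dvdn_d_in_semigroup; rewrite d1E; exact: ndvd.
  rewrite -r'E => b_eq /andP[n'j_gt1 lt_n'j].
  have [j_gt0 le_jg] := andP le_j; have g_gt0 := leq_trans j_gt0 le_jg.
  have lt_b : nth 0 r 0 < beta by have := Hl' 1 isT; rewrite /= mul1n.
  have b_eq0 := b_eq; rewrite r'E in b_eq0.
  have n'after k : j < k -> n_ r' k.+1 = n_ r k.
    by rewrite r'E; apply: n_insert_at_after b_eq0.
  have n'dvd k : 1 <= k -> n_ r' k.+1 %| n_ r k.
    by move=> k_gt0; rewrite r'E n_insert_at_dvdn // d_gt0 ?szr.
  have d'_eq := d_inserted szr dr (leq0n j) le_j b_eq0.
  rewrite -r'E in d'_eq.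
  (* This is n'_1 d'_2 = d'_1 = beta with beta = n'_{j+1} a_j d_{j+1} and d'_2 taken from
     [d_inserted], divided by n'_{j+1} d_{j+1}. *)
  have n'1_eq : n_ r' 1 * gcdn (a_ r j) (\prod_(1 <= i < j) n_ r i) = a_ r j.
    apply/eqP; rewrite -(eqn_pmul2l (ltnW n'j_gt1)).
    have dj : 0 < d_ r j.+1 by rewrite d_gt0 ?szr.
    rewrite -(eqn_pmul2r dj) -[_ * a_ r j * _]mulnA a_mul_d ?szr // -b_eq.
    by rewrite mulnCA -mulnA -d'_eq ?j_gt0 // -d'E n_mul_d // d'1.
  have aj_gt0 : 0 < a_ r j.
    have : 0 < nth 0 r j by apply: (allP r_gt0); rewrite mem_nth ?szr.
    by rewrite -(a_mul_d (r := r)) ?szr // muln_gt0 => /andP[].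
  exists j; split=> //; split.
  - split=> //; rewrite {1}b_eq (nth_eq_a_prod (r := r)) ?szr // mulnA //.
  - move=> j1; subst j.
    (* Both sides times d_2 equal r_0, since d'_2 = n'_2 d_2 when j = 1. *)
    have n1_eq : n_ r 1 = a_ r' 1 * n_ r' 2.
      have d2 : 0 < d_ r 2 by rewrite d_gt0 ?szr.
      apply/eqP; rewrite -(eqn_pmul2r d2) n_mul_d // d1E -a'1 d'E d'_eq //.
      by rewrite big_geq // gcdn1 muln1 mulnA.
    split=> //.
    + by move=> k /andP[? _]; apply: n'after.
    + split=> //; move: lt_n'j; rewrite n1_eq -{1}[n_ r' 2]mul1n ltn_pmul2r //.
      exact: ltnW.
    + by rewrite -{1}n'1_eq dvdn_mulr.
    + split.
        by rewrite -(ltn_pmul2r d'2_gt0) a'1 n_mul_d // d'1.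
      by apply/eqP/coprime_a_n; rewrite ?szr' // d'E d1 gcdn1.
  - move=> j2.
    have C : strictly_decreasing
                   (rcons [seq gcdn (a_ r j) (\prod_(l <= k < j) n_ r k)
                          | l <- index_iota 1 j] 1).
      apply: (@sorted_gcd_chain r g 0 1 beta j) => // i /andP[i_gt0 le_ij].
      by rewrite -r'E n'1 //= ltnS (leq_trans le_ij).
    split=> //.
    + split; first by rewrite -{1}n'1_eq dvdn_mulr.
      rewrite n'1 //= -{1}n'1_eq ltn_Pmulr //; last exact: ltnW (n'1 1 _).
      (* The cofactor of n'_1 in a_j is a multiple of n'_2, hence greater than 1. *)
      have := @n_mul_gcd r g 0 beta j 1 szr dr isT le_j b_eq0 b_gt0 isT j2.
      move=> <-; rewrite -r'E (leq_trans (n'1 2 _)) ?leq_pmulr //.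
      by rewrite gcdn_gt0 aj_gt0.
    + by move=> k /andP[k1 le_kj]; split; rewrite ?n'dvd // n'1 //= ltnS (leq_trans le_kj).
    + by exists j; rewrite j_gt0 leqnn; split=> // E; rewrite E ltnn in lt_n'j.
    + by move=> k /andP[? _]; apply: n'after.
  - split=> // k; rewrite leq_min => /and3P[k2 le_kj le_kg].
    by have := Hl' k.+1 le_kg; case: k k2 {le_kj le_kg}.
  - split.
      by have /dvdn_d_in_semigroup := Hs' 1 isT; rewrite d'1.
    move=> k /andP[k1 le_kj]; have := Hs' k.+1 => /=; apply.
    by rewrite /= ltnS (leq_trans le_kj).
have [j_gt0 le_jg] := andP le_j; rewrite /= in b_eq.
have n'1 i : 0 < i -> i <= j.+1 -> 1 < n_ r' i.
  move=> i_gt0 le_i; case: (ltngtP j 1) => [|j2|j1]; first by rewrite ltnNge j_gt0.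
    have [_ [_ /andP[n'1 _]] Hk _ _] := H2 j2.
    by case: i i_gt0 le_i => // -[|i] // _ /(Hk i.+1)[].
  have [_ _ [a'1_gt1 n'2_gt1] _ [lt_a' _]] := H1 j1.
  rewrite j1 in le_i; case: i i_gt0 le_i => // -[_ _|[|]] //.
  exact: leq_trans a'1_gt1 (ltnW lt_a').
have [|i i_gt0|i i_gt0|i i_gt0|dr' S] :=
    @delta_sequence_insert_at r g 0 beta j (n_ r' j.+1) szr dr b_gt0 _ b_eq.
- by rewrite le_jg.
- by rewrite -r'E => /andP[_]; apply: n'1.
- rewrite -r'E; case: i i_gt0 => // -[|i] _ le_i /=; last exact: Hs'.
  rewrite take0; case/dvdnP: Hd => q ->.
  by apply/in_semigroupM/mem_in_semigroup/mem_head.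
- rewrite -r'E; case: i i_gt0 => [|[|[|i]]] // _; rewrite leq_min => /and3P[_ le_i le_ig].
  + by rewrite /= mul1n.
  (* Position 2 compares r_1 with n'_1 r_0; it follows from r_1 < r_0, axiom (c) for r. *)
  + have /= := Hl 1 le_ig; rewrite mul1n => /leq_trans; apply.
    by rewrite leq_pmull // ltnW // n'1.
  + by apply: (Hl' i.+2); rewrite /= leq_min; apply/andP. 
rewrite -r'E in dr' S; do !split=> //.
  by move/(congr1 size); rewrite szr'.
(* If r_0 divided beta, every d'_{k+1} with k > 0 would equal d_k. Then n'_{k+1} = n_k throughout,
   against the index k_0 if j >= 2; and a'_1 = 1 if j = 1. *)
rewrite /= => dvd; have d'd k : 0 < k -> d_ r' k.+1 = d_ r k.
  move=> k_gt0; rewrite d'E (gcdn_idPr _) //; apply: dvdn_trans dvd.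
  by rewrite -d1E dvdn_d_le.
case: (ltngtP j 1) => [|j2|j1]; first by rewrite ltnNge j_gt0.
  have [_ _ _ [k0 [/andP[k0_gt0 _] neq]] _] := H2 j2.
  by case: neq; rewrite /n_ /= !d'd //; case: k0 k0_gt0.
have [_ _ [a'1_gt1 _] _ _] := H1 j1.
have := a'1; rewrite d'd // d1E -{2}[nth 0 r 0]mul1n => /eqP.
by rewrite eqn_pmul2r // => /eqP E; rewrite E in a'1_gt1.
Qed.

(** * Insertion after the first element *)

Lemma inner_insertion g r h beta (r' := take h r ++ beta :: drop h r) :
    size r = g.+1 -> delta_sequence r -> all (leq 1) r' -> 1 <= h <= g ->
  delta_sequence r' /\ same_semigroup r' r <->
      exists j : nat, h <= j <= g /\
       [/\ beta = n_ r' j.+1 * nth 0 r' j.+1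
           /\ beta = n_ r' j.+1 * a_ r j * \prod_(j.+1 <= k < g.+1) n_ r k,

           [/\ strictly_decreasing
                 (\prod_(h <= k < j.+1) n_ r k ::
                  rcons [seq gcdn (a_ r j) (\prod_(l <= k < j) n_ r k)
                        | l <- index_iota h j] 1),
               forall k, 1 <= k <= h.-1 -> n_ r' k = n_ r k,
               n_ r' h %| \prod_(h <= k < j.+1) n_ r k
               /\ 1 < n_ r' h < \prod_(h <= k < j.+1) n_ r k,
               (forall k, h <= k <= j -> n_ r' k.+1 %| n_ r k /\ 1 < n_ r' k.+1)
               /\ (exists k0, h <= k0 <= j /\ n_ r' k0.+1 <> n_ r k0) &
               forall k, j.+1 <= k <= g -> n_ r' k.+1 = n_ r k],

           nth 0 r h < n_ r' h * beta < n_ r' h * n_ r h.-1 * nth 0 r h.-1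
           /\ (forall k, h.+1 <= k <= minn j.+1 g ->
                 nth 0 r k < n_ r' k * nth 0 r k.-1) &

           [/\ in_semigroup (take h r) (n_ r' h * beta),
               in_semigroup (rcons (take h r) beta) (n_ r' h.+1 * nth 0 r h) &
               forall k, h.+2 <= k <= j.+1 ->
                 in_semigroup (take h r ++ beta :: drop h (take k.-1 r))
                              (n_ r' k * nth 0 r k.-1)]].
Proof.
move=> szr dr r'_gt0 /andP[h_gt0 le_hg].
have r'E : r' = insert_at h beta r by [].
have szr' : size r' = g.+2 by rewrite r'E size_insert_at szr.
have [r_gt0 d1 n1 Hs Hl] := (delta_sequenceP szr).1 dr.
have b_gt0 : 0 < beta by apply: (allP r'_gt0); rewrite mem_insert_at mem_head.
have szh : h <= size r by rewrite szr leqW.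
have d'E k : h <= k -> d_ r' k.+1 = gcdn beta (d_ r k).
  exact: d_insert_at_gt.
have d'h : d_ r' h = d_ r h by apply: d_insert_at_le.
have n'before k : k < h -> n_ r' k = n_ r k by apply: n_insert_at_lt.
have r'before k : k < h -> nth 0 r' k = nth 0 r k by apply: nth_insert_at_lt.
have r'h : nth 0 r' h = beta by apply: nth_insert_at_eq.
have r'after k : h <= k -> nth 0 r' k.+1 = nth 0 r k by apply: nth_insert_at_gt.
have lt_h1 : h.-1 < h by rewrite prednK.
have take_h : take h r' = take h r by apply: take_insert_at_le.
have take_hS : take h.+1 r' = rcons (take h r) beta.
  by rewrite take_insert_at_gt // /insert_at take_takel // drop_oversize ?cats1 ?size_takel.
have take_after k : h < k -> take k r' = take h r ++ beta :: drop h (take k.-1 r).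
  move=> lt_hk; rewrite -{1}(prednK (leq_ltn_trans (leq0n h) lt_hk)).
  have le_hk : h <= k.-1 by rewrite -ltnS (ltn_predK lt_hk).
  by rewrite take_insert_at_gt // /insert_at take_takel.
split=> [[dr' S]|[j [/andP[le_hj le_jg] [[b_eq _]]]]].
  have [_ _ n'1 Hs' Hl'] := (delta_sequenceP szr').1 dr'.
  have rb : in_semigroup r beta by apply: in_semigroup_same_insert_at S.
  have n'h_gt1 : 1 < n_ r' h by rewrite n'1 // h_gt0 leqW.
  have not_rb : ~ in_semigroup (take (maxn h 1) r) beta.
    (* If the terms before h generated beta, then d_h would divide beta and n'_h would be 1. *)
    rewrite (maxn_idPl h_gt0) => /dvdn_d_in_semigroup dvd.
    rewrite -d'h in dvd; move: n'h_gt1; rewrite /n_ gtn_eqF //.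
    by rewrite d_S r'h (gcdn_idPl dvd) divnn ltnNge leq_b1.
  have [j [le_hj le_j b_eq0 /andP[n'j_gt1 lt_n'j]]] :=
    inserted_eq szr dr (leqW le_hg) dr' rb not_rb.
  have [j_gt0 le_jg] := andP le_j.
  have b_eq : beta = n_ r' j.+1 * nth 0 r j by [].
  have n'after k : j < k -> n_ r' k.+1 = n_ r k.
    exact: n_insert_at_after szh le_hj b_eq0.
  have n'dvd k : h <= k -> n_ r' k.+1 %| n_ r k.
    move=> le_hk; apply: n_insert_at_dvdn => //; last by rewrite d_gt0 ?szr.
    exact: leq_trans le_hk.
  (* Both sides times d_{j+1} equal d_h: the left one is n'_h d'_{h+1} by [d_inserted]. *)
  have prod_eq : n_ r' h * (n_ r' j.+1 * gcdn (a_ r j) (\prod_(h <= i < j) n_ r i))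
      = \prod_(h <= k < j.+1) n_ r k.
    have dj : 0 < d_ r j.+1 by rewrite d_gt0 ?szr.
    apply/eqP; rewrite -(eqn_pmul2r dj) prod_n_mul_d ?h_gt0 ?leqW // -mulnA.
    by rewrite -(d_inserted szr dr le_hj le_j b_eq0) ?h_gt0 // -d'E // n_mul_d ?d'h.
  have prod_gt0 : 0 < \prod_(h <= k < j.+1) n_ r k.
    rewrite big_nat; apply: prodn_cond_gt0 => k /andP[le_hk lt_kj].
    by rewrite ltnW // n1 // (leq_trans h_gt0) //= (leq_trans _ le_jg).
  have gcd_gt0 : 0 < gcdn (a_ r j) (\prod_(h <= i < j) n_ r i).
    by move: prod_gt0; rewrite -prod_eq !muln_gt0 => /and3P[].
  have C := @sorted_gcd_chain r g h h beta j szr dr (leqnn h).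
  rewrite h_gt0 in C; have {}C := C le_hj le_jg b_eq0 b_gt0.
  exists j; rewrite le_hj le_jg; split=> //; split.
  - split; first by rewrite r'after.
    by rewrite {1}b_eq (nth_eq_a_prod (r := r)) ?szr // mulnA.
  - split.
    + rewrite /strictly_decreasing; move: C; set P := (\prod_(h <= k < j.+1) _) in prod_eq *.
      rewrite rcons_gcd_chain // /index_iota.
      rewrite subSn //= => -> //; last first.
        by move=> i /andP[le_hi le_ij]; rewrite n'1 //= ltnS (leq_trans le_ij).
      (* The head of the chain is its second term times n'_h n'_{j+1} > 1. *)
      rewrite andbT -prod_eq mulnA ltn_Pmull // (leq_trans n'h_gt1) //.
      by rewrite leq_pmulr // ltnW.
    + by move=> k /andP[_ le_k]; rewrite n'before // (leq_ltn_trans le_k).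
    + split; first by rewrite -prod_eq dvdn_mulr.
      rewrite n'h_gt1 /= -prod_eq ltn_Pmulr ?(ltnW n'h_gt1) //.
      by rewrite (leq_trans n'j_gt1) // leq_pmulr.
    + split=> [k /andP[le_hk le_kj]|].
        by rewrite n'dvd // n'1 //= ltnS (leq_trans le_kj).
      exists j; rewrite le_hj leqnn; split=> // E.
      by rewrite E ltnn in lt_n'j.
    + by move=> k /andP[lt_jk _]; apply: n'after.
  - split.
      (* Once n'_h is cancelled on the right, these are axiom (c) for r' at h+1 and at h. *)
      rewrite -mulnA ltn_pmul2l ?(ltnW n'h_gt1) //.
      have := Hl' h.+1; rewrite r'after // r'h => -> //=.
      by have := Hl' h; rewrite r'h h_gt0 leqW // r'before // n'before // => ->.
    move=> k; rewrite leq_min => /and3P[lt_hk _ le_kg].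
    have := Hl' k.+1 le_kg; rewrite r'after ?(ltnW lt_hk) //=.
    by case: k lt_hk {le_kg} => //= k lt_hk; rewrite r'after.
  - split.
    + by rewrite -take_h -r'h; apply: Hs'; rewrite h_gt0 leqW.
    + by rewrite -take_hS -(r'after h) //; apply: Hs'.
    + move=> k /andP[lt_hk le_kj].
      rewrite -take_after ?(ltnW lt_hk) // -(r'after k.-1); last first.
        by case: k lt_hk {le_kj} => //= k; rewrite ltnS => /ltnW.
      rewrite prednK ?(leq_trans _ lt_hk) //; apply: Hs'.
      by rewrite (leq_trans _ lt_hk) // (leq_trans le_kj).
move=> [_ _ [_ /andP[n'h_gt1 _]] [n'1 _] _] [/andP[lt_h lt_b] Hl'] [Hs1 Hs2 Hs3].
rewrite r'after // in b_eq.
apply: (@delta_sequence_insert_at r g h beta j (n_ r' j.+1)); rewrite ?le_hj //.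
all: rewrite -r'E => -[|i] // _ /andP[].
(* Each hypothesis of the criterion splits into position h, which holds beta, and the positions i+1
   with i >= h, which hold r_i. *)
all: rewrite leq_eqVlt => /predU1P[h_eq|]; last rewrite ltnS => le_hi.
- by rewrite -h_eq.
- by move=> le_ij; have [|_] := n'1 i; rewrite ?le_hi.
- by rewrite -h_eq take_h r'h.
- move=> le_ij; rewrite r'after //; move: le_hi; rewrite leq_eqVlt.
  case/predU1P=> [<-|lt_hi]; first by rewrite take_hS.
  by rewrite take_after ?ltnS ?(ltnW lt_hi) //; apply: (Hs3 i.+1); apply/andP.
- rewrite -h_eq r'h r'before // n'before // => _.
  by rewrite -(ltn_pmul2l (ltnW n'h_gt1)) mulnA.
- rewrite leq_min /= r'after // => /andP[le_ij le_ig]; move: le_hi; rewrite leq_eqVlt.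
  case/predU1P=> [<-|]; first by rewrite r'h.
  case: i le_ij le_ig => // i le_ij le_ig lt_hi; rewrite r'after //.
  by apply: (Hl' i.+1); rewrite lt_hi leq_min /=; apply/andP.
Qed.

Unset Implicit Arguments.

Theorem theorem5p2 (g : nat) (D D' : seq nat)
    (size_D : size D = g.+1) (delta_D : delta_sequence D)
    (size_D' : size D' = g.+2) (pos_D' : all (leq 1) D') :
  (forall beta : nat, D' = beta :: D ->
     (principal_delta_sequence D' /\ same_semigroup D' D
      <-> exists alpha : nat, 1 < alpha /\ beta = alpha * nth 0 D 0))
  /\
  (forall beta : nat, D' = beta :: D ->
     (nonprincipal_delta_sequence D' /\ same_semigroup D' D
      <->
      exists j : nat, 1 <= j <= g /\
       [/\ beta = n_ D' j.+1 * nth 0 D' j.+1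
           /\ beta = n_ D' j.+1 * a_ D j * \prod_(j.+1 <= k < g.+1) n_ D k,

           (j = 1 ->
             [/\ forall k, 2 <= k <= g -> n_ D' k.+1 = n_ D k,
                 n_ D 1 = a_ D' 1 * n_ D' 2,
                 1 < a_ D' 1 /\ 1 < n_ D' 2,
                 n_ D' 1 %| a_ D 1 &
                 a_ D' 1 < n_ D' 1 /\ gcdn (a_ D' 1) (n_ D' 1) = 1]),

           (2 <= j ->
             [/\ strictly_decreasing
                   (rcons [seq gcdn (a_ D j) (\prod_(l <= k < j) n_ D k)
                          | l <- index_iota 1 j] 1),
                 n_ D' 1 %| a_ D j /\ 1 < n_ D' 1 < a_ D j,
                 forall k, 1 <= k <= j -> n_ D' k.+1 %| n_ D k /\ 1 < n_ D' k.+1,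
                 exists k0, 1 <= k0 <= j /\ n_ D' k0.+1 <> n_ D k0 &
                 forall k, j.+1 <= k <= g -> n_ D' k.+1 = n_ D k]),

           beta > nth 0 D 0
           /\ (forall k, 2 <= k <= minn j.+1 g ->
                 nth 0 D k < n_ D' k * nth 0 D k.-1) &

           beta %| n_ D' 1 * nth 0 D 0
           /\ (forall k, 1 <= k <= j ->
                 in_semigroup (beta :: take k D) (n_ D' k.+1 * nth 0 D k))]))
  /\
  (forall (h beta : nat), 1 <= h <= g -> D' = take h D ++ beta :: drop h D ->
     (delta_sequence D' /\ same_semigroup D' D
      <->
      exists j : nat, h <= j <= g /\
       [/\ beta = n_ D' j.+1 * nth 0 D' j.+1
           /\ beta = n_ D' j.+1 * a_ D j * \prod_(j.+1 <= k < g.+1) n_ D k,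

           [/\ strictly_decreasing
                 (\prod_(h <= k < j.+1) n_ D k ::
                  rcons [seq gcdn (a_ D j) (\prod_(l <= k < j) n_ D k)
                        | l <- index_iota h j] 1),
               forall k, 1 <= k <= h.-1 -> n_ D' k = n_ D k,
               n_ D' h %| \prod_(h <= k < j.+1) n_ D k
               /\ 1 < n_ D' h < \prod_(h <= k < j.+1) n_ D k,
               (forall k, h <= k <= j -> n_ D' k.+1 %| n_ D k /\ 1 < n_ D' k.+1)
               /\ (exists k0, h <= k0 <= j /\ n_ D' k0.+1 <> n_ D k0) &
               forall k, j.+1 <= k <= g -> n_ D' k.+1 = n_ D k],

           nth 0 D h < n_ D' h * beta < n_ D' h * n_ D h.-1 * nth 0 D h.-1
           /\ (forall k, h.+1 <= k <= minn j.+1 g ->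
                 nth 0 D k < n_ D' k * nth 0 D k.-1) &

           [/\ in_semigroup (take h D) (n_ D' h * beta),
               in_semigroup (rcons (take h D) beta) (n_ D' h.+1 * nth 0 D h) &
               forall k, h.+2 <= k <= j.+1 ->
                 in_semigroup (take h D ++ beta :: drop h (take k.-1 D))
                              (n_ D' k * nth 0 D k.-1)]])).
Proof.
split=> [beta E|]; first by subst D'; apply: (principal_insertion size_D).
split=> [beta E|h beta h_in E]; subst D'; first exact: (nonprincipal_insertion size_D).
exact: (inner_insertion size_D).
Qed.
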